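(* Let $\varphi$ be a complete Bernstein function of the form $\varphi(x)=\int_0^\infty(1-e^{-sx})\overline\nu(s)\,ds$, with $\overline\nu$ a completely monotone Lévy density, satisfying $\lim_{\theta\to0}\varphi(\theta)=0$ and $\lim_{\theta\to\infty}\varphi(\theta)=+\infty$, and let $\nu(x)=\int_x^\infty\overline\nu(z)dz$, $x>0$. Assume $\overline\nu\in L^2(1,\infty)$ and $\nu\in L^2(0,1)\cap L^p(1,\infty)$ for some $p\ge1$, and let $$B_t^\nu=\sqrt{C_\nu}\int_{\mathbb R}\big[\nu((t-u)_+)-\nu((-u)_+)\big]dW_u,\qquad t\ge0 .$$ Then: (i) if $\nu\in L^2(\mathbb R^+)$, then $\lim_{t\to+\infty}\mathrm{Var}(B_t^\nu)=C$ for some constant $0<C<\infty$; (ii) if $\nu\notin L^2(\mathbb R^+)$, then $\lim_{t\to+\infty}\mathrm{Var}(B_t^\nu)=+\infty$ and $\lim_{t\to+\infty}\mathrm{Var}(B_t^\nu)/t=0$.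
   Context: A Lévy density satisfies $\int_0^\infty(s\wedge1)\overline\nu(s)ds<\infty$. $\nu$ is extended by $\nu(x)=0$ for $x\le0$, and $(x)_+=\max(x,0)$. $W=(W_u)_{u\in\mathbb R}$ is a two-sided Wiener process, and $C_\nu=\big(\int_{\mathbb R}[\nu((1-u)_+)-\nu((-u)_+)]^2du\big)^{-1}$ is a normalising constant. *)

(* Defs.v *)
From HB Require Import structures.
From mathcomp Require Import all_boot all_order all_algebra.
From mathcomp Require Import all_classical all_reals all_analysis.

Set Implicit Arguments.
Unset Strict Implicit.
Unset Printing Implicit Defensive.

Import Order.TTheory GRing.Theory Num.Theory.
Import numFieldNormedType.Exports.

Local Open Scope classical_set_scope.
Local Open Scope ring_scope.

Section bernstein.
Context {R : realType}.
Implicit Types (f phi m nubar nu : R -> R).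
Local Notation mu := (@lebesgue_measure R).

Definition completely_monotone f : Prop :=
  forall (n : nat) (x : R), 0 < x ->
    derivable (derive1n n f) x 1 /\ 0 <= (-1) ^+ n * derive1n n f x.

Definition levy_density m : Prop :=
  [/\ measurable_fun (`]0, +oo[ : set R) m,
      forall s, 0 < s -> 0 <= m s &
      (\int[mu]_(s in `]0%R, +oo[) (Num.min s 1 * m s)%:E < +oo)%E].

Definition levy_exponent m (x : R) : \bar R :=
  (\int[mu]_(s in `]0%R, +oo[) ((1 - expR (- (s * x))) * m s)%:E)%E.

Definition complete_bernstein phi : Prop :=
  exists (a b : R) (m : R -> R),
    [/\ 0 <= a, 0 <= b, completely_monotone m, levy_density m &
        forall x, 0 < x -> (phi x)%:E = ((a + b * x)%:E + levy_exponent m x)%E].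

(* [nubar] and [phi] are only meaningful on ]0, +oo[; the tail is extended
   by 0 to x <= 0. *)
Definition levy_tail nubar (x : R) : R :=
  if 0 < x then \int[mu]_(z in `]x, +oo[) nubar z else 0.

Definition Lp_on (D : set R) (p : R) f : Prop :=
  (f \_ D) \in Lfun mu p%:E.

Definition increment_kernel nu (t u : R) : R :=
  nu (Num.max (t - u) 0) - nu (Num.max (- u) 0).

Definition C_const nu : R := (\int[mu]_u (increment_kernel nu 1 u ^+ 2))^-1.

End bernstein.

Section wiener.
Context {d : measure_display} {T : measurableType d} {R : realType}.
Variable P : probability T R.
Local Notation mu := (@lebesgue_measure R).

(* Choosing some A i to be the full set gives the product rule for every
   subfamily. *)
Definition mutually_independent (n : nat) (X : 'I_n -> T -> R) : Prop :=
  forall A : 'I_n -> set R, (forall i, measurable (A i)) ->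
    P (\bigcap_(i in [set: 'I_n]) (X i @^-1` A i)) =
    (\prod_(i < n) P (X i @^-1` A i))%E.

Definition two_sided_wiener (W : R -> {RV P >-> R}) : Prop :=
  [/\ {ae P, forall w, W 0 w = 0},
      forall (n : nat) (t : nat -> R), {homo t : i j / (i <= j)%N >-> i <= j} ->
        mutually_independent (fun (i : 'I_n) w => W (t i.+1) w - W (t i) w),
      (* the second parameter of normal_prob is the standard deviation *)
      forall s t : R, s < t -> forall A : set R, measurable A ->
        P ((fun w => W t w - W s w) @^-1` A) =
        normal_prob 0 (Num.sqrt (t - s)) A &
      {ae P, forall w, continuous (fun t => W t w)}].

Record step := Step {
  step_size : nat;
  step_node : nat -> R;
  step_coef : nat -> R;
  step_mono : {homo step_node : i j / (i <= j)%N >-> i <= j} }.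

Definition step_fun (s : step) (x : R) : R :=
  \sum_(i < step_size s)
    step_coef s i * \1_(`]step_node s i, step_node s i.+1]) x.

Definition step_integral (W : R -> {RV P >-> R}) (s : step) (w : T) : R :=
  \sum_(i < step_size s)
    step_coef s i * (W (step_node s i.+1) w - W (step_node s i) w).

(* I is (a version of) the Wiener integral of f against W: the L^2(P)-limit
   of the integrals of step functions converging to f in L^2(R); by the
   isometry it does not depend, up to a null set, on the step functions. *)
Definition is_wiener_integral (W : R -> {RV P >-> R}) (f : R -> R)
    (I : {RV P >-> R}) : Prop :=
  measurable_fun [set: R] f /\
  exists s : nat -> step,
    (\int[mu]_x ((step_fun (s k) x - f x) ^+ 2)%:E)%E @[k --> \oo] --> 0%E /\
    (\int[P]_w ((step_integral W (s k) w - I w) ^+ 2)%:E)%E @[k --> \oo]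
      --> 0%E.

Definition is_bernstein_motion (W : R -> {RV P >-> R}) (nu : R -> R)
    (B : R -> {RV P >-> R}) : Prop :=
  forall t : R, 0 <= t ->
    exists2 I : {RV P >-> R}, is_wiener_integral W (increment_kernel nu t) I &
      {ae P, forall w, B t w = Num.sqrt (C_const nu) * I w}.

End wiener.

(* Main.v *)
(* The variance of [B t] is a constant times [V t], the squared L2 norm of the
   kernel [u |-> nu (t - u) - nu (- u)]. For this Ito isometry, scaling the
   normal law gives Var (W t - W s) = c (t - s) for some c > 0, polarization
   makes disjoint increments uncorrelated, and L2 limits pass through
   Var (X + Y) <= (1 + e) Var X + (1 + 1/e) Var Y.

   Reflecting the half-lines u < 0 and u >= 0 gives
     V t = int_(s > 0) (nu s - nu (t + s))^2 ds + int_(x <= t) nu x ^2 dx,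
   which is nondecreasing in t since nu is nonincreasing. If nu is in L2, then
   V is bounded by twice the squared norm of nu; otherwise the second integral
   is unbounded. Finally, 0 <= nu s - nu (t + s) <= t nubar s because nubar is
   nonincreasing, so that for every a > 0
     V t <= 2 int_(x <= a) nu x ^2 dx + 2 t (nu a)^2,
   and nu a tends to 0 at infinity. *)
Require Import Defs.
From HB Require Import structures.
From mathcomp Require Import all_boot all_order all_algebra.
From mathcomp Require Import all_classical all_reals all_analysis.
From mathcomp Require Import measurable_realfun ring lra.

Set Implicit Arguments.
Unset Strict Implicit.
Unset Printing Implicit Defensive.

Import Order.TTheory GRing.Theory Num.Theory.
Import numFieldNormedType.Exports.

Local Open Scope classical_set_scope.
Local Open Scope ring_scope.

(** * Affine changes of variables in Lebesgue integrals *)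

Section change_of_variables.
Context {R : realType}.
Local Notation mu := (@lebesgue_measure R).
Local Open Scope ereal_scope.

(** Lebesgue measure is determined by its values on half-open intervals, so the hypothesis on []a,
    b]] identifies it with [k] times its image under [phi]. Reflections and dilations are both of
    this kind. *)
Lemma ge0_integral_itv_scaling (k : {nonneg R})
    (phi : measurableTypeR R -> measurableTypeR R) (D : set R)
    (f : R -> \bar R) :
  measurable_fun [set: measurableTypeR R] phi ->
  (forall a b : R, mu `]a, b] = k%:num%:E * mu (phi @^-1` `]a, b])) ->
  measurable D -> measurable_fun D f -> (forall x, D x -> 0 <= f x) ->
  \int[mu]_(x in D) f x = k%:num%:E * \int[mu]_(x in phi @^-1` D) f (phi x).
Proof.
move=> mphi muE mD mf f0.
have f0' : {in D, forall x, 0 <= f x} by move=> x; rewrite inE => /f0.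
rewrite -[X in _ * X](ge0_integral_pushforward mphi mu mD mf f0').
rewrite -ge0_integral_mscale//; apply: eq_measure_integral => A mA _.
by apply: lebesgue_measure_unique => // _ [[a b]] _ <-; exact: muE.
Qed.

Lemma ge0_integral_reflect (t : R) (f : R -> \bar R) :
  measurable_fun [set: R] f -> (forall x, 0 <= f x) ->
  \int[mu]_x f (t - x)%R = \int[mu]_x f x.
Proof.
move=> mf f0; apply/esym.
rewrite (@ge0_integral_itv_scaling (NngNum ler01) (fun x => t - x)%R)//=.
- by rewrite mul1e preimage_setT.
- exact: measurable_funB.
- move=> a b; rewrite mul1e.
  have -> : (fun x => t - x)%R @^-1` `]a, b] = `[(t - b)%R, (t - a)%R[%classic :> set R.
    by apply/seteqP; split=> x /=; rewrite !in_itv/= => /andP[? ?];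
      apply/andP; split; lra.
  rewrite !lebesgue_measure_itv/= !lte_fin ltrD2l ltrN2.
  by case: ifP => // _; rewrite -!EFinB; congr EFin; ring.
Qed.

Lemma ge0_integral_dilate (s : R) (D : set R) (f : R -> \bar R) : (0 < s)%R ->
  measurable D -> measurable_fun D f -> (forall x, D x -> 0 <= f x) ->
  \int[mu]_(x in D) f x = s%:E * \int[mu]_(x in *%R s @^-1` D) f (s * x)%R.
Proof.
move=> s0 mD mf f0.
rewrite (@ge0_integral_itv_scaling (NngNum (ltW s0)) ( *%R s))//= => a b.
have -> : *%R s @^-1` `]a, b] = `](a / s)%R, (b / s)%R]%classic :> set R.
  by apply/seteqP; split=> x /=; rewrite !in_itv/= ltr_pdivrMr// ler_pdivlMr//
    mulrC.
rewrite !lebesgue_measure_itv/= !lte_fin ltr_pM2r ?invr_gt0//.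
case: ifP => _; rewrite ?mule0// -!EFinB -EFinM; congr EFin.
by field; rewrite gt_eqF.
Qed.

End change_of_variables.

(** * Integration against a measure given by a density *)

Section density.
Context d (T : measurableType d) (R : realType).
Variables (mu nu : {measure set T -> \bar R}) (g : T -> R).
Local Open Scope ereal_scope.
Hypothesis mg : measurable_fun [set: T] g.
Hypothesis g0 : forall x, (0 <= g x)%R.
Hypothesis nuE : forall A, measurable A -> nu A = \int[mu]_(x in A) (g x)%:E.

Import HBNNSimple.

Let mgE : measurable_fun [set: T] (EFin \o g).
Proof. exact/measurable_EFinP. Qed.

Let integral_density_nnsfun (h : {nnsfun T >-> R}) :
  \int[nu]_x (h x)%:E = \int[mu]_x ((h x)%:E * (g x)%:E).
Proof.
under eq_integral do rewrite fimfunE -fsumEFin//.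
rewrite ge0_integral_fsum//; last 2 first.
- by move=> r; exact/measurable_EFinP/measurable_funM.
- by move=> r x _; rewrite nnfun_muleindic_ge0.
under [RHS]eq_integral => x _.
  rewrite fimfunE -fsumEFin// ge0_mule_fsuml; last first.
    by move=> r; rewrite nnfun_muleindic_ge0.
  over.
rewrite ge0_integral_fsum//; last 2 first.
- move=> r; apply: emeasurable_funM => //.
  exact/measurable_EFinP/measurable_funM.
- by move=> r x _; rewrite mule_ge0 ?nnfun_muleindic_ge0 ?lee_fin.
apply: eq_fsbigr => r _.
have mh : measurable (h @^-1` [set r]) by exact: measurable_sfunP.
rewrite integralZl_indic_nnsfun// integral_indic// setIT nuE//.
under [RHS]eq_integral do rewrite EFinM -muleA.
(* A nonnegative simple function takes no negative value, so both sides vanish when [r < 0];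
   otherwise [r] can be pulled out of the integral. *)
have [r0|r0] := leP 0%R r; last first.
  rewrite preimage_nnfun0// integral_set0 mule0 integral0_eq// => x _.
  by rewrite indic0/= mul0e mule0.
rewrite ge0_integralZl//; last 2 first.
- by apply: emeasurable_funM => //; exact/measurable_EFinP.
- by move=> x _; rewrite mule_ge0 ?lee_fin.
congr (_ * _); rewrite integral_mkcond; apply: eq_integral => x _.
by rewrite patchE indicE; case: (x \in _); rewrite ?mul1e ?mul0e.
Qed.

(** Simple functions are handled level set by level set; monotone convergence along an increasing
    simple approximation, used on both sides, gives the general case. *)
Lemma ge0_integral_density (f : T -> R) :
  measurable_fun [set: T] f -> (forall x, (0 <= f x)%R) ->
  \int[nu]_x (f x)%:E = \int[mu]_x (f x * g x)%:E.
Proof.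
move=> mf f0; have mfE : measurable_fun [set: T] (EFin \o f).
  exact/measurable_EFinP.
pose h := nnsfun_approx measurableT mfE.
have cvgh x : (EFin \o h n) x @[n --> \oo] --> (f x)%:E.
  by apply: cvg_nnsfun_approx => // y _; rewrite lee_fin.
have ndh x : nondecreasing_seq (fun n => (h n x)%:E).
  by move=> m n mn; rewrite lee_fin; exact/lefP/nd_nnsfun_approx.
transitivity (limn (fun n => \int[nu]_x (h n x)%:E)).
  rewrite -monotone_convergence//.
  - by apply: eq_integral => x _; apply/esym/cvg_lim => //; exact: cvgh.
  - by move=> n; exact/measurable_EFinP.
  - by move=> n x _; rewrite lee_fin.
under eq_fun do rewrite integral_density_nnsfun.
rewrite -monotone_convergence//.
- apply: eq_integral => x _; apply/cvg_lim => //.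
  by rewrite EFinM; apply: cvgeZr => //; exact: cvgh.
- by move=> n; apply: emeasurable_funM => //; exact/measurable_EFinP.
- by move=> n x _; rewrite mule_ge0 ?lee_fin.
- by move=> x _ m n mn; rewrite lee_wpmul2r ?lee_fin//; have := ndh x m n mn; rewrite lee_fin.
Qed.

End density.

(** * The centred normal laws *)

Section normal.
Context {R : realType}.
Local Notation mu := (@lebesgue_measure R).
Local Open Scope ereal_scope.

(** Under the substitution by [s * x], the Jacobian [s] cancels the factor [s] in the normalisation
    of the density. *)
Lemma normal_prob_dilate (s : R) (A : set R) : (0 < s)%R -> measurable A ->
  normal_prob 0 s A = normal_prob 0 1 ( *%R s @^-1` A).
Proof.
move=> s0 mA; rewrite /normal_prob (ge0_integral_dilate s0)//; last 2 first.
- apply: measurable_funTS; apply/measurable_EFinP.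
  exact: measurable_normal_pdf.
- by move=> x _; rewrite lee_fin normal_pdf_ge0.
rewrite -ge0_integralZl//; last 4 first.
- have := @mulrl_measurable R setT s measurableT A mA; rewrite setTI; exact.
- apply: measurable_funTS; apply/measurable_EFinP.
  by apply: measurableT_comp; [exact: measurable_normal_pdf|exact: mulrl_measurable].
- by move=> x _; rewrite lee_fin normal_pdf_ge0.
- by rewrite lee_fin ltW.
apply: eq_integral => x _; rewrite -EFinM !normal_pdfE ?gt_eqF//; congr EFin.
rewrite mulrA /normal_peak /normal_fun; congr (_ * expR _)%R.
  rewrite expr1n mul1r -mulrnAr sqrtrM ?sqr_ge0// sqrtr_sqr gtr0_norm//.
  by rewrite invfM mulrA divff ?mul1r// gt_eqF.
by rewrite !subr0 expr1n -mulr_natr; field; rewrite gt_eqF.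
Qed.

(** The function [x ^+ 2] times the standard density is dominated by a multiple of the density of
    standard deviation 2, whose integral is 1. *)
Lemma normal_moment2_lty : \int[normal_prob 0 1]_x (x ^+ 2)%:E < +oo :> \bar R.
Proof.
rewrite (@ge0_integral_density _ _ _ mu _ (normal_pdf 0 1))//; last first.
- by move=> x; rewrite sqr_ge0.
- by move=> x; rewrite normal_pdf_ge0.
- exact: measurable_normal_pdf.
apply: (@le_lt_trans _ _ (\int[mu]_x (8%:E * (normal_pdf 0 2 x)%:E))); last first.
  rewrite ge0_integralZl//; last 2 first.
  - by apply/measurable_EFinP; exact: measurable_normal_pdf.
  - by move=> x _; rewrite lee_fin normal_pdf_ge0.
  by rewrite integral_normal_pdf mule1 ltry.
apply: ge0_le_integral => //.
- by move=> x _; rewrite lee_fin mulr_ge0 ?sqr_ge0 ?normal_pdf_ge0.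
- by apply/measurable_EFinP/measurable_funM => //; exact: measurable_normal_pdf.
- apply/measurable_EFinP/measurable_funM => //; exact: measurable_normal_pdf.
move=> x _; rewrite -EFinM lee_fin !normal_pdfE//.
have -> : normal_peak 1 = (2 * normal_peak 2 :> R)%R.
  rewrite /normal_peak expr1n mul1r -mulrnAr sqrtrM ?sqr_ge0// sqrtr_sqr.
  by rewrite gtr0_norm// invfM mulrA divff ?mul1r.
have -> : normal_fun 0 1 x =
    (normal_fun 0 2 x * expR (- (3 / 8 * x ^+ 2)))%R.
  by rewrite /normal_fun -expRD; congr expR; field.
(* This is [1 + y <= expR y] at [y = 3 / 8 * x ^+ 2], where [3 / 8 = 1 / 2 - 1 / 8] is the gap
   between the two exponents. With the factor 2 between the peaks, the resulting constant is
   [16 / 3], below the 8 chosen above. *)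
have le1 : (x ^+ 2 * expR (- (3 / 8 * x ^+ 2)) <= 8 / 3)%R.
  rewrite expRN ler_pdivrMr ?expR_gt0//.
  have := expR_ge1Dx (3 / 8 * x ^+ 2)%R; lra.
have := normal_peak_ge0 (2 : R); have := normal_fun_ge0 0 (2 : R) x.
set p := normal_peak _; set q := normal_fun _ _ _ => q0 p0.
have : (p * q * (x ^+ 2 * expR (- (3 / 8 * x ^+ 2))) <= p * q * (8 / 3))%R.
  by rewrite ler_wpM2l// mulr_ge0.
have : (0 <= p * q)%R by rewrite mulr_ge0.
lra.
Qed.

End normal.

(** * Square-integrable functions *)

Section square_integrable.
Context d (T : measurableType d) (R : realType).
Variable mu : {measure set T -> \bar R}.
Local Open Scope ereal_scope.
Implicit Types f g : T -> R.

Lemma Lfun2P f : f \in Lfun mu 2%:E <->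
  measurable_fun [set: T] f /\ \int[mu]_x (f x ^+ 2)%:E < +oo.
Proof.
split=> [f2|[mf f2]].
  split; first by have := sub_Lfun_mfun f2; rewrite inE.
  by apply: integrable_lty => //; exact: Lfun2_integrable_sqr.
rewrite inE; apply/andP; split; rewrite inE//= /finite_norm unlock poweR_lty//.
under eq_integral do rewrite /= powR_mulrn// real_normK ?num_real//.
exact: f2.
Qed.

(** Young's inequality [2 * f * g <= e * f ^+ 2 + e^-1 * g ^+ 2]. The factor [1 + e] can be taken
    close to 1, so squared norms pass to L2 limits when [g] is the error. *)
Lemma integral_sqrD_le f g (e : R) : (0 < e)%R ->
  measurable_fun [set: T] f -> measurable_fun [set: T] g ->
  \int[mu]_x ((f x + g x) ^+ 2)%:E <=
  (1 + e)%:E * \int[mu]_x (f x ^+ 2)%:E +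
  (1 + e^-1)%:E * \int[mu]_x (g x ^+ 2)%:E.
Proof.
move=> e0 mf mg.
have e1 : (0 < e^-1)%R by rewrite invr_gt0.
have m2 (h : T -> R) : measurable_fun [set: T] h ->
    measurable_fun [set: T] (fun x => (h x ^+ 2)%:E).
  by move=> mh; apply/measurable_EFinP; exact: measurable_funX.
have sq0 (h : T -> R) (k : R) x : (0 < k)%R -> 0 <= (1 + k)%:E * (h x ^+ 2)%:E.
  by move=> k0; rewrite -EFinM lee_fin mulr_ge0 ?sqr_ge0// addr_ge0// ltW.
rewrite -!ge0_integralZl//; try exact: m2;
  try (by move=> x _; rewrite lee_fin sqr_ge0);
  try (by rewrite lee_fin addr_ge0// ltW).
rewrite -ge0_integralD//; try (by move=> x _; exact: sq0);
  try (apply: emeasurable_funM => //; exact: m2).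
apply: ge0_le_integral => //.
- by move=> x _; rewrite lee_fin sqr_ge0.
- by apply: m2; exact: measurable_funD.
- by apply: emeasurable_funD; apply: emeasurable_funM => //; exact: m2.
- move=> x _; rewrite -!EFinM -EFinD lee_fin -subr_ge0.
  have -> : ((1 + e) * f x ^+ 2 + (1 + e^-1) * g x ^+ 2 - (f x + g x) ^+ 2 =
    e^-1 * (e * f x - g x) ^+ 2)%R by field; rewrite gt_eqF.
  by rewrite mulr_ge0 ?sqr_ge0 ?ltW.
Qed.

End square_integrable.

(** * Variance under addition, equality in law and almost sure equality *)

Section variance_lemmas.
Context d (T : measurableType d) (R : realType) (P : probability T R).
Local Open Scope ereal_scope.

Lemma Lfun2_Lfun1 (X : T -> R) : X \in Lfun P 2%:E -> X \in Lfun P 1.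
Proof. by apply: Lfun_subset12; exact: fin_num_measure. Qed.

Lemma variance_le_moment2 (X : T -> R) : X \in Lfun P 2%:E ->
  'V_P[X] <= \int[P]_w (X w ^+ 2)%:E.
Proof.
move=> X2; rewrite varianceE//.
have -> : 'E_P[X ^+ 2] = \int[P]_w (X w ^+ 2)%:E.
  by rewrite unlock; apply: eq_integral => w _.
rewrite -(fineK (expectation_fin_num (Lfun2_Lfun1 X2))) -EFin_expe.
by rewrite leeBlDr// leeDl// lee_fin sqr_ge0.
Qed.

(** Expanding [0 <= Var (e * X - Y)] bounds twice the covariance by [e * Var X + e^-1 * Var Y]; this
    is the counterpart of [integral_sqrD_le] for variances. *)
Lemma varianceD_le (X Y : T -> R) (e : R) : (0 < e)%R ->
  X \in Lfun P 2%:E -> Y \in Lfun P 2%:E ->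
  'V_P[(X \+ Y)%R] <= (1 + e)%:E * 'V_P[X] + (1 + e^-1)%:E * 'V_P[Y].
Proof.
move=> e0 X2 Y2.
have eX2 : (e \o* X)%R \in Lfun P 2%:E by rewrite Lfun_scale// ler1n.
have X1 := Lfun2_Lfun1 X2; have Y1 := Lfun2_Lfun1 Y2.
have XY1 := Lfun2_mul_Lfun1 X2 Y2.
have := variance_ge0 P (e \o* X \- Y)%R.
rewrite varianceB// varianceZ// varianceD//.
rewrite covarianceZl//.
rewrite -(fineK (variance_fin_num X2)) -(fineK (variance_fin_num Y2)).
rewrite -(fineK (covariance_fin_num X1 Y1 XY1)).
rewrite -!EFinM -!EFinD -?EFinN -?EFinD !lee_fin.
set a := fine _; set b := fine _; set k := fine _ => h.
rewrite -subr_ge0.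
have -> : ((1 + e) * a + (1 + e^-1) * b - (a + b + 2 * k) =
  e^-1 * (e ^+ 2 * a + b - 2 * (e * k)))%R by field; rewrite gt_eqF.
by rewrite mulr_ge0// invr_ge0 ltW.
Qed.

Lemma eq_law_integral (X Y : {RV P >-> R}) (f : R -> R) :
  (forall A, measurable A -> P (X @^-1` A) = P (Y @^-1` A)) ->
  measurable_fun [set: R] f -> (forall x, (0 <= f x)%R) ->
  \int[P]_w (f (X w))%:E = \int[P]_w (f (Y w))%:E.
Proof.
move=> XY mf f0.
have mfE : measurable_fun [set: R] (EFin \o f) by exact/measurable_EFinP.
have f0E x : 0 <= (EFin \o f) x by rewrite lee_fin.
rewrite -(ge0_integral_distribution X mfE f0E).
rewrite -(ge0_integral_distribution Y mfE f0E).
by apply: eq_measure_integral => A mA _; exact: XY.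
Qed.

Lemma eq_law_Lfun2 (X Y : {RV P >-> R}) :
  (forall A, measurable A -> P (X @^-1` A) = P (Y @^-1` A)) ->
  (X : T -> R) \in Lfun P 2%:E -> (Y : T -> R) \in Lfun P 2%:E.
Proof.
move=> XY /Lfun2P[_ X2]; apply/Lfun2P; split => //.
rewrite -(@eq_law_integral X Y (fun x => x ^+ 2)%R XY)// => x.
by rewrite sqr_ge0.
Qed.

Lemma eq_law_variance (X Y : {RV P >-> R}) :
  (forall A, measurable A -> P (X @^-1` A) = P (Y @^-1` A)) ->
  (X : T -> R) \in Lfun P 2%:E -> 'V_P[X] = 'V_P[Y].
Proof.
move=> XY X2; have Y2 := eq_law_Lfun2 XY X2.
rewrite !varianceE//; congr (_ - _ ^+ 2).
  rewrite unlock; apply: (@eq_law_integral X Y (fun x => x ^+ 2)%R) => // x.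
  by rewrite sqr_ge0.
rewrite !expectation_def.
have mE : measurable_fun [set: R] (@EFin R) by exact/measurable_EFinP.
have intE (Z : {RV P >-> R}) : (Z : T -> R) \in Lfun P 2%:E ->
    P.-integrable [set: T] (EFin \o Z).
  by move=> Z2; exact/Lfun1_integrable/Lfun2_Lfun1.
rewrite -(integral_distribution mE (intE _ X2)).
rewrite -(integral_distribution mE (intE _ Y2)).
by apply: eq_measure_integral => A mA _; exact: XY.
Qed.

Lemma ae_eq_variance (X Y : {RV P >-> R}) :
  {ae P, forall w, X w = Y w} -> 'V_P[X] = 'V_P[Y].
Proof.
move=> XY.
have EXY : 'E_P[X] = 'E_P[Y].
  rewrite !expectation_def; apply: ae_eq_integral => //.
  - exact/measurable_EFinP.
  - exact/measurable_EFinP.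
  - by apply: filterS XY => w XYw _; rewrite XYw.
rewrite /variance unlock EXY unlock; apply: ae_eq_integral => //.
- by apply/measurable_EFinP; apply: measurable_funM; exact: measurable_funB.
- by apply/measurable_EFinP; apply: measurable_funM; exact: measurable_funB.
- by apply: filterS XY => w XYw _; rewrite !fctE/= XYw.
Qed.

End variance_lemmas.

(** * The isometry for the Wiener integral *)

Section wiener_isometry.
Context {d : measure_display} {T : measurableType d} {R : realType}.
Variables (P : probability T R) (W : R -> {RV P >-> R}).
Hypothesis hW : two_sided_wiener W.
Local Notation mu := (@lebesgue_measure R).
Local Open Scope ereal_scope.

Let Z : {RV P >-> R} := (W 1 \- W 0)%R.

(* Equal to 1, but only its positivity matters. *)
Definition wiener_unit_variance : R := fine 'V_P[(W 1 \- W 0)%R].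

Local Notation c := wiener_unit_variance.

Let lawZ (A : set R) : measurable A -> P (Z @^-1` A) = normal_prob 0 1 A.
Proof.
by move=> mA; case: hW => _ _ /(_ 0%R 1%R ltr01 A mA) + _; rewrite subr0 sqrtr1.
Qed.

Let Z2 : (Z : T -> R) \in Lfun P 2%:E.
Proof.
apply/Lfun2P; split => //.
have mZ : measurable_fun [set: T] (Z : T -> measurableTypeR R).
  exact: (measurable_funPT Z).
have mf : measurable_fun [set: measurableTypeR R]
    (fun x : measurableTypeR R => (x ^+ 2)%:E).
  by apply/measurable_EFinP; exact: measurable_funX.
have f0 : {in [set: measurableTypeR R], forall x : measurableTypeR R,
    0 <= (x ^+ 2)%:E} by move=> x _; rewrite lee_fin sqr_ge0.
have := ge0_integral_pushforward mZ P measurableT mf f0.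
rewrite preimage_setT => <-.
apply: le_lt_trans (@normal_moment2_lty R).
by rewrite le_eqVlt; apply/orP; left; apply/eqP;
  apply: eq_measure_integral => A mA _; exact: lawZ.
Qed.

(** If the variance vanished, [W 1 - W 0] would almost surely equal its mean, whereas a normal law
    gives no mass to a point. *)
Lemma wiener_unit_variance_gt0 : (0 < c)%R.
Proof.
have c0 : (0 <= c)%R by rewrite fine_ge0// variance_ge0.
rewrite lt_neqAle c0 andbT; apply/eqP => c0'.
have VZ : 'V_P[Z] = 0 by rewrite -(fineK (variance_fin_num Z2)) -/c -c0'.
set m := fine 'E_P[Z].
have mZ : measurable_fun [set: T] (fun w => Z w - m)%R by exact: measurable_funB.
have : \int[P]_w `|((Z w - m) * (Z w - m))%:E| = 0.
  rewrite -VZ /variance unlock [in RHS]unlock; apply: eq_integral => w _.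
  rewrite gee0_abs; last by rewrite lee_fin -expr2 sqr_ge0.
  by rewrite /m expectation_def.
move/(ae_eq_integral_abs _ measurableT) => /(_ _)[|N [mN PN sN]].
  by apply/measurable_EFinP; exact: measurable_funM.
have mA : measurable (Z @^-1` [set m]) by exact: measurable_sfunP.
have PA : P (Z @^-1` [set m]) = 0.
  by rewrite lawZ// /normal_prob integral_set1.
have : P [set: T] <= P (Z @^-1` [set m]) + P N.
  apply: le_trans (measureU2 P mA mN).
  apply: le_measure; rewrite ?inE//; first exact: measurableU.
  move=> w _; have [Zm|Zm] := pselect (Z w = m); [by left|right].
  apply: sN => /= /(_ I) [] /eqP; rewrite mulf_eq0 orbb subr_eq0.
  by move/eqP.
by rewrite PA [P N]PN adde0 probability_setT lee_fin ler10.
Qed.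

(** By scaling of normal laws, [W t - W s] has the law of [Num.sqrt (t - s)] times [W 1 - W 0] when
    [s < t]; for [s = t] the increment is constantly 0. *)
Lemma wiener_increment_variance (s t : R) : (s <= t)%R ->
  (W t \- W s : T -> R)%R \in Lfun P 2%:E /\
  'V_P[(W t \- W s)%R] = (c * (t - s))%:E.
Proof.
rewrite le_eqVlt => /predU1P[->|st].
  have -> : (W t \- W t = cst 0 :> (T -> R))%R.
    by apply/funext => w /=; rewrite subrr.
  by rewrite Lfun_cst variance_cst subrr mulr0.
pose sg := Num.sqrt (t - s).
have sg0 : (0 < sg)%R by rewrite sqrtr_gt0 subr_gt0.
pose Y : {RV P >-> R} := (sg \o* Z)%R.
have Y2 : (Y : T -> R) \in Lfun P 2%:E by rewrite Lfun_scale// ler1n.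
have eqlaw (A : set R) : measurable A ->
    P (Y @^-1` A) = P ((W t \- W s : {RV P >-> R})%R @^-1` A).
  move=> mA; have -> : Y @^-1` A = Z @^-1` ( *%R sg @^-1` A).
    by apply/seteqP; split => w /=; rewrite mulrC.
  rewrite lawZ; last first.
    by have := @mulrl_measurable R setT sg measurableT A mA; rewrite setTI.
  rewrite -normal_prob_dilate//; apply/esym.
  by case: hW => _ _ /(_ s t st A mA) + _.
split; first exact: (eq_law_Lfun2 eqlaw Y2).
rewrite -(eq_law_variance eqlaw Y2) varianceZ// sqr_sqrtr ?subr_ge0 ?ltW//.
by rewrite -(fineK (variance_fin_num Z2)) -EFinM mulrC.
Qed.

Let inc2 (s t : R) : (s <= t)%R -> (W t \- W s : T -> R)%R \in Lfun P 2%:E.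
Proof. by move=> /wiener_increment_variance[]. Qed.

(* Polarization of the variance identity. *)
Lemma wiener_increment_adjacent_covariance (s t u : R) : (s <= t <= u)%R ->
  covariance P (W t \- W s)%R (W u \- W t)%R = 0.
Proof.
move=> /andP[st tu]; have su := le_trans st tu.
have [X2 VX] := wiener_increment_variance st.
have [Y2 VY] := wiener_increment_variance tu.
have [_ VXY] := wiener_increment_variance su.
have := varianceD X2 Y2.
have -> : ((W t \- W s) \+ (W u \- W t) = W u \- W s :> (T -> R))%R.
  by apply/funext => w /=; ring.
have := covariance_fin_num (Lfun2_Lfun1 X2) (Lfun2_Lfun1 Y2)
  (Lfun2_mul_Lfun1 X2 Y2).
move=> /fineK <-; rewrite VX VY VXY -EFinM -!EFinD => -[] h.
by congr EFin; move: h; set k := fine _ => h; lra.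
Qed.

(** [W v - W u] is the difference of the increments from [b] to [v] and from [b] to [u], both
    adjacent to the one from [a] to [b]. *)
Lemma wiener_increment_covariance (a b u v : R) :
  (a <= b)%R -> (b <= u)%R -> (u <= v)%R ->
  covariance P (W b \- W a)%R (W v \- W u)%R = 0.
Proof.
move=> ab bu uv; have bv := le_trans bu uv.
have -> : (W v \- W u = (W v \- W b) \- (W u \- W b) :> (T -> R))%R.
  by apply/funext => w /=; ring.
rewrite covarianceBr ?inc2// !wiener_increment_adjacent_covariance ?ab//.
exact: subee.
Qed.

(** * Step functions and their integrals *)

Section step.
Variables (node coef : nat -> R).
Hypothesis mono : {homo node : i j / (i <= j)%N >-> (i <= j)%R}.

Let Dl i : T -> R := (W (node i.+1) \- W (node i))%R.
Let SI n : T -> R := fun w => (\sum_(i < n) coef i * Dl i w)%R.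
Let SF n (x : R) : R :=
  (\sum_(i < n) coef i * \1_(`]node i, node i.+1]) x)%R.

Let SIS n : SI n.+1 = (SI n \+ coef n \o* Dl n)%R.
Proof. by apply/funext => w; rewrite /SI big_ord_recr/= [X in (_ + X)%R]mulrC. Qed.

Let SI0 : SI 0 = cst 0%R.
Proof. by apply/funext => w; rewrite /SI big_ord0. Qed.

Let Dl2 n : Dl n \in Lfun P 2%:E. Proof. by apply: inc2; exact: mono. Qed.

Let cDl2 n : (coef n \o* Dl n)%R \in Lfun P 2%:E.
Proof. by rewrite Lfun_scale// ler1n. Qed.

Lemma step_integral_Lfun2 n : SI n \in Lfun P 2%:E.
Proof.
elim: n => [|n IH]; first by rewrite SI0 Lfun_cst.
by rewrite SIS rpredD ?lee1n//=.
Qed.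

(** All the increments in [SI n] end by [node n <= node m], so each is uncorrelated with [Dl m]. *)
Let cov_SI n m : (n <= m)%N -> covariance P (SI n) (Dl m) = 0.
Proof.
elim: n => [|n IH] nm; first by rewrite SI0 covariance_cst_l.
rewrite SIS covarianceDl ?step_integral_Lfun2// IH ?(ltnW nm)// add0e.
have n1 := Lfun2_Lfun1 (Dl2 n); have m1 := Lfun2_Lfun1 (Dl2 m).
have nm1 := Lfun2_mul_Lfun1 (Dl2 n) (Dl2 m).
rewrite covarianceZl//.
by rewrite wiener_increment_covariance ?mule0//; exact: mono.
Qed.

Lemma step_integral_variance_sum n :
  'V_P[SI n] = (c * \sum_(i < n) coef i ^+ 2 * (node i.+1 - node i))%:E.
Proof.
elim: n => [|n IH]; first by rewrite SI0 variance_cst big_ord0 mulr0.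
have S2 := step_integral_Lfun2 n.
have S1 := Lfun2_Lfun1 S2; have D1 := Lfun2_Lfun1 (Dl2 n).
have SD1 := Lfun2_mul_Lfun1 S2 (Dl2 n).
rewrite SIS varianceD// IH varianceZ// covarianceZr// cov_SI// !mule0 adde0.
have [_ ->] := wiener_increment_variance (mono (leqnSn n)).
rewrite -EFinM -EFinD big_ord_recr/=; congr EFin; ring.
Qed.

Let SF_right n x : (node n < x)%R -> SF n x = 0%R.
Proof.
move=> nx; rewrite /SF big1// => i _; rewrite indicE memNset ?mulr0//=.
rewrite in_itv/= => /andP[_ xi]; have : (node i.+1 <= node n)%R by exact: mono.
by rewrite leNgt (lt_le_trans nx xi).
Qed.

(** The interval added at stage [n] lies to the right of all earlier ones, so the square has no
    cross term. *)
Let SFS n x : (SF n.+1 x ^+ 2 =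
  SF n x ^+ 2 + coef n ^+ 2 * \1_(`]node n, node n.+1]) x)%R.
Proof.
rewrite {1}/SF big_ord_recr/= -/(SF n x) indicE.
have [|_] := boolP (x \in _); last by rewrite !mulr0 !addr0.
rewrite inE/= in_itv/= => /andP[nx _]; rewrite SF_right//.
by rewrite !mulr1 add0r expr0n add0r.
Qed.

Lemma measurable_step_fun n : measurable_fun [set: R] (SF n).
Proof.
by apply: measurable_sum => i; apply: measurable_funM => //; exact: measurable_indic.
Qed.

Lemma integral_step_fun_sqr n : \int[mu]_x (SF n x ^+ 2)%:E =
  (\sum_(i < n) coef i ^+ 2 * (node i.+1 - node i))%:E.
Proof.
elim: n => [|n IH].
  by rewrite big_ord0 integral0_eq// => x _; rewrite /SF big_ord0 expr0n.
under eq_integral do rewrite SFS EFinD.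
rewrite ge0_integralD//; last 4 first.
- by move=> x _; rewrite lee_fin sqr_ge0.
- by apply/measurable_EFinP; exact: (measurable_funX _ (measurable_step_fun n)).
- by move=> x _; rewrite lee_fin mulr_ge0 ?sqr_ge0.
- by apply/measurable_EFinP; apply: measurable_funM => //; exact: measurable_indic.
rewrite IH; under eq_integral do rewrite (EFinM (coef n ^+ 2)).
rewrite ge0_integralZl//; last 2 first.
- by apply: measurableT_comp => //; exact: measurable_indic.
- by rewrite lee_fin sqr_ge0.
rewrite integral_indic//= setIT lebesgue_measure_itv/= lte_fin big_ord_recr/=.
have := mono (leqnSn n); rewrite le_eqVlt => /predU1P[->|->].
  by rewrite ltxx subrr mulr0 mule0 adde0 addr0.
by rewrite -EFinB -EFinM -EFinD.
Qed.

End step.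

(** The variance and the squared norm both reduce to the sum of
    [coef i ^+ 2 * (node i.+1 - node i)], up to the factor [c]. *)
Lemma step_integral_isometry (s : step) :
  [/\ step_integral W s \in Lfun P 2%:E, measurable_fun [set: R] (step_fun s),
      \int[mu]_x (step_fun s x ^+ 2)%:E \is a fin_num &
      'V_P[step_integral W s] = c%:E * \int[mu]_x (step_fun s x ^+ 2)%:E].
Proof.
case: s => n t a mono; rewrite /step_fun /step_integral/=.
rewrite (step_integral_variance_sum a mono) (integral_step_fun_sqr a mono).
by split=> //; [exact: step_integral_Lfun2|exact: measurable_step_fun].
Qed.

Let near_lt (u : nat -> \bar R) (e : R) : u k @[k --> \oo] --> 0 ->
  (0 < e)%R -> \forall k \near \oo, u k < e%:E.
Proof.
move=> /fine_cvgP[ufin u0] e0; near=> k.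
rewrite -(@fineK _ (u k)); last by near: k.
by rewrite lte_fin; near: k; exact: (cvgr_lt 0%R).
Unshelve. all: by end_near. Qed.

Let le_of_small_error (x y M : R) :
  (forall e, (0 < e < 1)%R -> (x <= y + e * M)%R) -> (x <= y)%R.
Proof.
move=> H; rewrite leNgt; apply/negP => yx.
have N0 : (0 < `|M| + 1 + (x - y))%R by rewrite addr_gt0 ?subr_gt0// ltr_wpDl.
(* The denominator exceeds both [x - y], so that [e < 1], and the absolute value of [M], so that
   [e * M < x - y]. *)
pose e := ((x - y) / (`|M| + 1 + (x - y)))%R.
have e0 : (0 < e)%R by rewrite divr_gt0 ?subr_gt0.
have e1 : (e < 1)%R by rewrite ltr_pdivrMr// mul1r ltrDr ltr_wpDl.
have := H e; rewrite e0 e1 => /(_ isT).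
have : (e * M <= e * `|M|)%R by rewrite ler_pM2l// ler_norm.
have : (e * (`|M| + 1 + (x - y)) = x - y)%R by rewrite divfK// gt_eqF.
have : (0 < e * (x - y))%R by rewrite mulr_gt0// subr_gt0.
nra.
Qed.

(** For step functions the identity is exact. The squared norm and the variance are each compared
    with those of a close step function, and the errors are then made arbitrarily small. *)
Lemma wiener_integral_isometry (f : R -> R) (I : {RV P >-> R}) :
  is_wiener_integral W f I ->
  [/\ \int[mu]_x (f x ^+ 2)%:E \is a fin_num, (I : T -> R) \in Lfun P 2%:E &
      'V_P[I] = c%:E * \int[mu]_x (f x ^+ 2)%:E].
Proof.
move=> [mf [s [sf sI]]].
have small (e : R) : (0 < e)%R -> exists k,
    \int[mu]_x ((step_fun (s k) x - f x) ^+ 2)%:E < e%:E /\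
    \int[P]_w ((step_integral W (s k) w - I w) ^+ 2)%:E < e%:E.
  move=> e0; near \oo => k; exists k.
  by split; near: k; exact: near_lt.
have F0 : 0 <= \int[mu]_x (f x ^+ 2)%:E.
  by apply: integral_ge0 => x _; rewrite lee_fin sqr_ge0.
have fB k : \int[mu]_x (f x ^+ 2)%:E =
    \int[mu]_x ((step_fun (s k) x + (f x - step_fun (s k) x)) ^+ 2)%:E.
  by apply: eq_integral => x _; congr (_ ^+ 2)%:E; ring.
have sB k : \int[mu]_x (step_fun (s k) x ^+ 2)%:E =
    \int[mu]_x ((f x + (step_fun (s k) x - f x)) ^+ 2)%:E.
  by apply: eq_integral => x _; congr (_ ^+ 2)%:E; ring.
have dN k : \int[mu]_x ((f x - step_fun (s k) x) ^+ 2)%:E =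
    \int[mu]_x ((step_fun (s k) x - f x) ^+ 2)%:E.
  by apply: eq_integral => x _; congr EFin; ring.
(* One approximation with squared errors below 1 already shows that [f] and [I] are square
   integrable. *)
have [k0 [d0 e0]] := small 1%R ltr01.
have Ffin : \int[mu]_x (f x ^+ 2)%:E \is a fin_num.
  have [_ ms afin _] := step_integral_isometry (s k0).
  rewrite ge0_fin_numE// (fB k0).
  have mB := measurable_funB mf ms.
  have /le_lt_trans := integral_sqrD_le mu ltr01 ms mB; apply.
  rewrite dN -(fineK afin); apply: lte_add_pinfty; first by rewrite -EFinM ltry.
  apply: lte_mul_pinfty => //.
  exact: lt_trans d0 (ltry _).
have I2 : (I : T -> R) \in Lfun P 2%:E.
  have [S2 _ _ _] := step_integral_isometry (s k0).
  have D2 : (step_integral W (s k0) \- I)%R \in Lfun P 2%:E.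
    have [mS _] := (Lfun2P P _).1 S2.
    apply/Lfun2P; split; first exact: measurable_funB.
    exact: lt_trans e0 (ltry _).
  have -> : (I : T -> R) = (step_integral W (s k0) -
      (step_integral W (s k0) \- I))%R.
    by apply/funext => w; rewrite !fctE/=; ring.
  by rewrite rpredB ?lee1n.
split=> //.
have VIfin := variance_fin_num I2.
set F := fine (\int[mu]_x (f x ^+ 2)%:E).
set V := fine 'V_P[I].
have cpos := ltW wiener_unit_variance_gt0.
have F0' : (0 <= F)%R by exact: fine_ge0.
have V0' : (0 <= V)%R by apply: fine_ge0; exact: variance_ge0.
suff VF : V = (c * F)%R by rewrite -(fineK VIfin) -(fineK Ffin) -EFinM -VF.
(* Here [a] is the squared norm of a step function close to [f], and [c * a] is the variance of its
   integral. *)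
have main (e : R) : (0 < e < 1)%R -> exists a : R,
    [/\ (F <= (1 + e) * a + 2 * e)%R, (a <= (1 + e) * F + 2 * e)%R,
        (V <= (1 + e) * (c * a) + 2 * e)%R & (c * a <= (1 + e) * V + 2 * e)%R].
  move=> /andP[e_gt0 e_lt1].
  (* A squared error below [e ^+ 2], multiplied by the factor [1 + e^-1] of the error terms, is at
     most [e ^+ 2 + e <= 2 * e]. *)
  have [k [dk ek]] := small (e ^+ 2)%R (exprn_gt0 _ e_gt0).
  have [S2 ms afin VS] := step_integral_isometry (s k).
  have mB := measurable_funB mf ms.
  have mB' := measurable_funB ms mf.
  set dd := \int[mu]_x _ in dk; set ee := \int[P]_w _ in ek.
  have dd0 : 0 <= dd by apply: integral_ge0 => x _; rewrite lee_fin sqr_ge0.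
  have ee0 : 0 <= ee by apply: integral_ge0 => x _; rewrite lee_fin sqr_ge0.
  have ddfin : dd \is a fin_num by rewrite ge0_fin_numE// (lt_trans dk (ltry _)).
  have eefin : ee \is a fin_num by rewrite ge0_fin_numE// (lt_trans ek (ltry _)).
  have dd1 : (fine dd < e ^+ 2)%R by rewrite -lte_fin fineK.
  have ee1 : (fine ee < e ^+ 2)%R by rewrite -lte_fin fineK.
  have err (r : R) : (r < e ^+ 2)%R -> ((1 + e^-1) * r <= 2 * e)%R.
    move=> re; apply: (@le_trans _ _ ((1 + e^-1) * e ^+ 2)%R).
      by rewrite ler_wpM2l ?ltW// ltr_wpDl// invr_gt0.
    have -> : ((1 + e^-1) * e ^+ 2 = e ^+ 2 + e)%R by field; rewrite gt_eqF.
    nra.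
  set A := \int[mu]_x (step_fun (s k) x ^+ 2)%:E in afin VS.
  have D2 : (step_integral W (s k) \- I)%R \in Lfun P 2%:E.
    by rewrite rpredB ?lee1n.
  have VD : 'V_P[(step_integral W (s k) \- I)%R] <= ee.
    exact: variance_le_moment2.
  have VDfin := variance_fin_num D2.
  have VDle : (fine 'V_P[(step_integral W (s k) \- I)%R] <= fine ee)%R.
    by rewrite fine_le.
  exists (fine A); split.
  - have := integral_sqrD_le mu e_gt0 ms mB.
    rewrite -fB dN -/A -/dd -(fineK Ffin) -(fineK afin) -(fineK ddfin).
    rewrite -!EFinM -EFinD lee_fin => /le_trans; apply.
    by rewrite lerD2l err.
  - have := integral_sqrD_le mu e_gt0 mf mB'.
    rewrite -sB -/A -/dd -(fineK Ffin) -(fineK afin) -(fineK ddfin).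
    rewrite -!EFinM -EFinD lee_fin => /le_trans; apply.
    by rewrite lerD2l err.
  - have ND2 : (\- (step_integral W (s k) \- I))%R \in Lfun P 2%:E.
      by rewrite rpredN.
    have := varianceD_le e_gt0 S2 ND2.
    have -> : (step_integral W (s k) \+ \- (step_integral W (s k) \- I) = I :> (T -> R))%R.
      by apply/funext => w /=; ring.
    rewrite varianceN// VS -(fineK VIfin) -(fineK afin) -(fineK VDfin).
    rewrite -!EFinM -EFinD lee_fin => /le_trans; apply.
    by rewrite lerD2l err// (le_lt_trans VDle).
  - have := varianceD_le e_gt0 I2 D2.
    have -> : (I \+ (step_integral W (s k) \- I) = step_integral W (s k) :> (T -> R))%R.
      by apply/funext => w /=; ring.
    rewrite VS -(fineK VIfin) -(fineK afin) -(fineK VDfin).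
    rewrite -!EFinM -EFinD lee_fin => /le_trans; apply.
    by rewrite lerD2l err// (le_lt_trans VDle).
apply/eqP; rewrite eq_le; apply/andP; split.
(* The bounds are chained through [a]. Since [e < 1], [(1 + e) ^+ 2 <= 1 + 3 * e] and
   [2 * e * (1 + e) <= 4 * e], which gives this constant and the one for the converse inequality. *)
- apply: (@le_of_small_error _ _ (3 * (c * F) + 4 * c + 2)) => e e01.
  have [a [_ aF Va _]] := main e e01; case/andP: e01 => e_gt0 e_lt1.
  have : ((1 + e) * (c * a) <= (1 + e) * (c * ((1 + e) * F + 2 * e)))%R.
    by rewrite ler_wpM2l ?ler_wpM2l// addr_ge0// ltW.
  have : (0 <= c * F)%R by rewrite mulr_ge0.
  set p := (c * F)%R.
  have -> : ((1 + e) * (c * ((1 + e) * F + 2 * e)) =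
    (1 + e) ^+ 2 * p + 2 * e * (1 + e) * c)%R by rewrite /p; ring.
  have ee (x : R) : (0 <= x -> e * e * x <= e * x)%R.
    by move=> x0; rewrite ler_wpM2r// ler_piMl// ltW.
  move=> p0; have := ee p p0; have := ee _ cpos.
  lra.
- apply: (@le_of_small_error _ _ (3 * V + 4 + 2 * c)) => e e01.
  have [a [Fa _ _ aV]] := main e e01; case/andP: e01 => e_gt0 e_lt1.
  have : (c * F <= c * ((1 + e) * a + 2 * e))%R by rewrite ler_wpM2l.
  have : ((1 + e) * (c * a) <= (1 + e) * ((1 + e) * V + 2 * e))%R.
    by rewrite ler_wpM2l// addr_ge0// ltW.
  have -> : (c * ((1 + e) * a + 2 * e) = (1 + e) * (c * a) + 2 * e * c)%R by ring.
  have ee (x : R) : (0 <= x -> e * e * x <= e * x)%R.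
    by move=> x0; rewrite ler_wpM2r// ler_piMl// ltW.
  have := ee V V0'; have := ee 1%R ler01.
  lra.
Unshelve. all: by end_near. Qed.

End wiener_isometry.

(** * Nonincreasing functions *)

Lemma is_interval_nonincreasing_measurable (R : realType) (D : set R)
    (f : R -> R) : is_interval D ->
  (forall x y, D x -> D y -> x <= y -> f y <= f x) -> measurable_fun D f.
Proof.
move=> iD f_ni; apply: (measurability (@RGenCInfty.G R)) => [|/= _ [_] [r] -> <-].
  exact: RGenCInfty.measurableE.
(* The superlevel sets of a nonincreasing function on an interval are intervals. *)
apply: is_interval_measurable => s t [Ds _] [Dt ft] u /andP[su ut].
move: ft; rewrite /= in_itv/= andbT => ft.
have Du : D u by apply: (iD s t) => //; rewrite su ut.
by split=> //=; rewrite in_itv/= andbT (le_trans ft)// f_ni.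
Qed.

(** The sign condition of order 1 makes the derivative nonpositive; order 0 gives differentiability,
    hence continuity up to [x]. *)
Lemma completely_monotone_nonincreasing (R : realType) (f : R -> R) :
  completely_monotone f -> forall x y, 0 < x -> x <= y -> f y <= f x.
Proof.
move=> cm x y x0 xy; apply: (@ler0_derive1_nincry _ f x) => //.
- move=> z; rewrite in_itv/= andbT => xz.
  by have [] := cm 0%N z (lt_trans x0 xz).
- move=> z; rewrite in_itv/= andbT => xz.
  have [_] := cm 1%N z (lt_trans x0 xz).
  by rewrite expr1 mulN1r oppr_ge0.
- apply: derivable_within_continuous => z; rewrite in_itv/= andbT => xz.
  by have [] := cm 0%N z (lt_le_trans x0 xz).
Qed.

(** * The tail of the Levy density *)

Section levy_tail_theory.
Context {R : realType}.
Variable nubar : R -> R.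
Hypothesis nubar_cm : completely_monotone nubar.
Hypothesis nubar_levy : levy_density nubar.
Local Notation mu := (@lebesgue_measure R).
Local Notation nu := (levy_tail nubar).
Local Open Scope ereal_scope.

Let mnubar : measurable_fun (`]0%R, +oo[ : set R) nubar.
Proof. by case: nubar_levy. Qed.

Let nubar0 (x : R) : (0 < x -> 0 <= nubar x)%R.
Proof. by case: nubar_levy => _ + _; exact. Qed.

Let nubar_ni := completely_monotone_nonincreasing nubar_cm.

Let nubar0E (D : set R) : D `<=` `]0%R, +oo[ ->
  forall z, D z -> 0 <= (nubar z)%:E.
Proof.
by move=> D0 z /D0; rewrite /= in_itv/= andbT => z0; rewrite lee_fin nubar0.
Qed.

Let mnubarE (D : set R) : D `<=` `]0%R, +oo[ ->
  measurable_fun D (fun z => (nubar z)%:E).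
Proof.
by move=> D0; apply/measurable_EFinP; apply: measurable_funS D0 mnubar.
Qed.

Let sub_oy (x : R) : (0 < x)%R -> `]x, +oo[%classic `<=` (`]0%R, +oo[ : set R).
Proof. by move=> x0; apply: subset_itvr; rewrite bnd_simp ltW. Qed.

Let sub_oc (x y : R) : (0 < x)%R -> `]x, y]%classic `<=` (`]0%R, +oo[ : set R).
Proof. by move=> x0 z /=; rewrite !in_itv/= andbT => /andP[/(lt_trans x0)]. Qed.

(** Beyond [x] the weight [Num.min z 1] is at least [m], so [nubar] is at most [m^-1] times the
    integrand of the Levy condition. *)
Lemma levy_tail_integral_lty (x : R) : (0 < x)%R ->
  \int[mu]_(z in `]x, +oo[) (nubar z)%:E < +oo.
Proof.
move=> x0; pose m := Num.min x 1%R.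
have m0 : (0 < m)%R by rewrite lt_min x0 ltr01.
case: nubar_levy => _ _ fin.
apply: (@le_lt_trans _ _ (\int[mu]_(z in `]0%R, +oo[)
    ((m^-1)%:E * (Num.min z 1 * nubar z)%:E))); last first.
  rewrite ge0_integralZl//.
  - by rewrite lte_mul_pinfty// lee_fin invr_ge0 ltW.
  - apply/measurable_EFinP; apply: measurable_funM => //.
    by apply: measurable_minr.
  - move=> z /=; rewrite in_itv/= andbT => z0.
    by rewrite lee_fin mulr_ge0 ?nubar0// le_min ltW//= ler01.
  - by rewrite lee_fin invr_ge0 ltW.
apply: (@le_trans _ _ (\int[mu]_(z in `]x, +oo[)
    ((m^-1)%:E * (Num.min z 1 * nubar z)%:E))).
  apply: ge0_le_integral => //.
  - exact: nubar0E (sub_oy x0).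
  - exact: mnubarE (sub_oy x0).
  - apply/measurable_EFinP; apply: measurable_funM => //.
    apply: measurable_funM; last exact: measurable_funS (sub_oy x0) mnubar.
    by apply: measurable_minr.
  - move=> z /=; rewrite in_itv/= andbT => xz.
    rewrite -EFinM lee_fin mulrA ler_peMl ?nubar0 ?(lt_trans x0)//.
    by rewrite mulrC ler_pdivlMr// mul1r le_min !ge_min lexx orbT andbT ltW.
apply: ge0_subset_integral => //.
- apply/measurable_EFinP; apply: measurable_funM => //.
  by apply: measurable_funM => //; exact: measurable_minr.
- move=> z /=; rewrite in_itv/= andbT => z0.
  by rewrite -EFinM lee_fin mulr_ge0 ?invr_ge0 ?(ltW m0)// mulr_ge0 ?nubar0//
    le_min ltW//= ler01.
- exact: sub_oy.
Qed.

(** The real-valued integral in [levy_tail] would default to 0 on an infinite integral; finiteness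
    identifies it with the extended one. *)
Lemma levy_tailE (x : R) : (0 < x)%R ->
  (nu x)%:E = \int[mu]_(z in `]x, +oo[) (nubar z)%:E.
Proof.
move=> x0; rewrite /levy_tail x0 /Rintegral fineK//.
rewrite ge0_fin_numE ?levy_tail_integral_lty// integral_ge0//.
exact: nubar0E (sub_oy x0).
Qed.

Lemma levy_tail_le0 (x : R) : (x <= 0)%R -> nu x = 0%R.
Proof. by move=> x0; rewrite /levy_tail ltNge x0. Qed.

Lemma levy_tail_ge0 (x : R) : (0 <= nu x)%R.
Proof.
have [x0|x0] := ltP 0%R x; last by rewrite levy_tail_le0.
by rewrite -lee_fin levy_tailE// integral_ge0//; exact: nubar0E (sub_oy x0).
Qed.

Lemma levy_tail_split (x y : R) : (0 < x)%R -> (x <= y)%R ->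
  (nu x)%:E = \int[mu]_(z in `]x, y]) (nubar z)%:E + (nu y)%:E.
Proof.
move=> x0 xy; have y0 := lt_le_trans x0 xy.
have E : `]x, +oo[%classic = `]x, y] `|` `]y, +oo[ :> set R.
  by rewrite -itv_bndbnd_setU// bnd_simp.
rewrite !levy_tailE// E ge0_integral_setU//.
- by rewrite -E; exact: mnubarE (sub_oy x0).
- by rewrite -E; exact: nubar0E (sub_oy x0).
- apply/disj_setPS => z [] /=; rewrite !in_itv/= andbT => /andP[_ zy] yz.
  by move: (lt_le_trans yz zy); rewrite ltxx.
Qed.

Let mu_oc (x y : R) : (x <= y)%R -> mu `]x, y] = (y - x)%:E.
Proof.
rewrite lebesgue_measure_itv/= lte_fin le_eqVlt => /predU1P[->|->//].
by rewrite ltxx subrr.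
Qed.

(** The difference is the integral of [nubar] over []x, y]], where monotonicity keeps [nubar]
    between [nubar y] and [nubar x]. *)
Lemma levy_tail_diff (x y : R) : (0 < x)%R -> (x <= y)%R ->
  ((y - x) * nubar y <= nu x - nu y <= (y - x) * nubar x)%R.
Proof.
move=> x0 xy; rewrite lerBrDr lerBlDr -!lee_fin !EFinD (levy_tail_split x0 xy).
rewrite !leeD2rE// !EFinM -!mu_oc//; apply/andP; split.
- rewrite muleC -integral_cst//; apply: ge0_le_integral => //.
  + by move=> z _; rewrite lee_fin nubar0// (lt_le_trans x0).
  + exact: mnubarE (@sub_oc _ _ x0).
  + move=> z /=; rewrite in_itv/= => /andP[xz zy].
    by rewrite lee_fin nubar_ni// (lt_trans x0).
- rewrite muleC -integral_cst//; apply: ge0_le_integral => //.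
  + exact: nubar0E (@sub_oc _ _ x0).
  + exact: mnubarE (@sub_oc _ _ x0).
  + move=> z /=; rewrite in_itv/= => /andP[xz zy].
    by rewrite lee_fin nubar_ni// ltW.
Qed.

Lemma levy_tail_nonincreasing (x y : R) : (0 < x)%R -> (x <= y)%R ->
  (nu y <= nu x)%R.
Proof.
move=> x0 xy; have /andP[+ _] := levy_tail_diff x0 xy.
rewrite -(subr_ge0 (nu y)); apply: le_trans.
by rewrite mulr_ge0 ?subr_ge0// nubar0// (lt_le_trans x0).
Qed.

Lemma measurable_levy_tail : measurable_fun [set: R] nu.
Proof.
have -> : nu = nu \_ `]0%R, +oo[.
  apply/funext => x; rewrite patchE; case: ifPn => //.
  rewrite notin_setE/= in_itv/= andbT => /negP; rewrite -leNgt.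
  exact: levy_tail_le0.
apply/(measurable_restrictT nu (measurable_itv `]0%R, +oo[)).
apply: is_interval_nonincreasing_measurable.
  move=> s t /=; rewrite !in_itv/= !andbT => s0 _ u /andP[su _].
  by rewrite in_itv/= andbT (lt_le_trans s0).
move=> x y /=; rewrite !in_itv/= !andbT => x0 _.
exact: levy_tail_nonincreasing.
Qed.

(** The integrals of [nubar] over []1, n + 1]] increase to [nu 1], and what is missing is
    [nu (n + 1)]. As [nu] is nonincreasing on the positive reals, one such point expresses its decay
    at infinity. *)
Lemma levy_tail_small (e : R) : (0 < e)%R ->
  exists2 a : R, (1 <= a)%R & (nu a < e)%R.
Proof.
move=> e0.
have bigE : \bigcup_i `]1%R, i.+1%:R]%classic = `]1%R, +oo[%classic :> set R.
  apply/seteqP; split=> [z [i _] /=|z /=].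
    by rewrite !in_itv/= andbT => /andP[].
  rewrite in_itv/= andbT => z1; exists (Num.truncn z) => //=.
  by rewrite in_itv/= z1 ltW// truncnS_gt.
pose F (i : nat) : set (measurableTypeR R) := `]1%R, i.+1%:R]%classic.
have nndF : nondecreasing_seq F.
  move=> i j ij; rewrite subsetEset; apply: subset_itvl.
  by rewrite bnd_simp ler_nat ltnS.
have mF i : measurable (F i) by exact: measurable_itv.
have mf i : measurable_fun (F i) (fun z => (nubar z)%:E).
  exact: mnubarE (@sub_oc _ _ ltr01).
have f0 i (z : R) : F i z -> 0 <= (nubar z)%:E.
  exact: nubar0E (@sub_oc _ _ ltr01) _.
have := @ge0_nondecreasing_set_cvg_integral _ _ R F _ mu nndF mF mf f0.
rewrite bigE -levy_tailE//.
move=> /fine_cvgP[_ /cvgrPdist_lt/(_ _ e0)[n _ /(_ n (leqnn n))]].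
have le1 : (1 <= n.+1%:R :> R)%R by rewrite ler1n.
have := levy_tail_split ltr01 le1.
set J := \int[mu]_(_ in _) _ => JE lt1.
exists n.+1%:R => //.
have Jfin : J \is a fin_num.
  have : J + (nu n.+1%:R)%:E \is a fin_num by rewrite -JE.
  by rewrite fin_numD => /andP[].
apply: le_lt_trans lt1 => /=.
move: JE; rewrite -(fineK Jfin) -EFinD => -[->].
by rewrite addrAC subrr add0r ler_norm.
Qed.

End levy_tail_theory.

(** * The energy of the increment kernel *)

Section kernel_energy.
Context {R : realType}.
Variable nubar : R -> R.
Hypothesis nubar_cm : completely_monotone nubar.
Hypothesis nubar_levy : levy_density nubar.
Local Notation mu := (@lebesgue_measure R).
Local Notation nu := (levy_tail nubar).
(** [H t] and [G t] are the contributions to [V t] of [u < 0] and of [u >= 0], after reflection. The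
    domain of [G t] can start at -oo because [nu] vanishes on the nonpositive reals. *)
Local Notation V t := (\int[mu]_u (increment_kernel nu t u ^+ 2)%:E)%E.
Local Notation G t := (\int[mu]_(x in `]-oo, t%R]) (nu x ^+ 2)%:E)%E.
Local Notation H t :=
  (\int[mu]_(s in `]0%R, +oo[) ((nu s - nu (t + s)%R) ^+ 2)%:E)%E.
Local Open Scope ereal_scope.

Let mnu : measurable_fun [set: R] nu := measurable_levy_tail nubar_cm nubar_levy.
Let nu_ge0 := levy_tail_ge0 nubar_levy.
Let nu_ni := levy_tail_nonincreasing nubar_cm nubar_levy.

Let mnu2 (D : set R) : measurable_fun D (fun x => (nu x ^+ 2)%:E).
Proof.
by apply: measurable_funTS; apply/measurable_EFinP; exact: measurable_funX.
Qed.

Let mdiff2 (D : set R) (t : R) :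
  measurable_fun D (fun s => ((nu s - nu (t + s)) ^+ 2)%:E).
Proof.
apply: measurable_funTS; apply/measurable_EFinP; apply: measurable_funX.
apply: measurable_funB => //; apply: (measurableT_comp mnu).
exact: measurable_funD.
Qed.

Lemma increment_kernel_levy_tail (t u : R) :
  increment_kernel nu t u = (nu (t - u) - nu (- u))%R.
Proof.
have pos x : nu (Num.max x 0%R) = nu x.
  by have [x0|//] := leP x 0%R; rewrite !levy_tail_le0.
by rewrite /increment_kernel !pos.
Qed.

Lemma kernel_energyE (t : R) : V t = H t + G t.
Proof.
pose f (u : R) := ((nu (t - u) - nu (- u)) ^+ 2)%:E.
have mf : measurable_fun [set: R] f.
  apply/measurable_EFinP; apply: measurable_funX.
  by apply: measurable_funB; apply: (measurableT_comp mnu) => //;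
    exact: measurable_funB.
have f0 u : 0 <= f u by rewrite lee_fin sqr_ge0.
transitivity (\int[mu]_u f u).
  by apply: eq_integral => u _; rewrite increment_kernel_levy_tail.
have TE : [set: R] = `]-oo, 0%R[ `|` `[0%R, +oo[.
  apply/seteqP; split=> // x _ /=; rewrite !in_itv/= andbT.
  by have [x0|x0] := ltP x 0%R; [left|right].
rewrite TE ge0_integral_setU//; last 2 first.
- exact: measurable_funTS.
- apply/disj_setPS => x [] /=; rewrite !in_itv/= andbT => x0.
  by rewrite leNgt x0.
pose h (s : R) := ((nu s - nu (t + s)) ^+ 2)%:E.
have mh : measurable_fun [set: R] (h \_ `]0%R, +oo[).
  by apply/(measurable_restrictT h (measurable_itv `]0%R, +oo[)); exact: mdiff2.
pose g (x : R) := (nu x ^+ 2)%:E.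
have mg : measurable_fun [set: R] (g \_ `]-oo, t]).
  by apply/(measurable_restrictT g (measurable_itv `]-oo, t])); exact: mnu2.
(* The reflection [u |-> - u] carries the negative half-line to []0, +oo[], and the square absorbs
   the change of sign. *)
have -> : \int[mu]_(u in `]-oo, 0%R[) f u = H t.
  rewrite integral_mkcond [RHS]integral_mkcond.
  rewrite -[RHS](@ge0_integral_reflect _ 0%R); last 2 first.
  - exact: mh.
  - by move=> x; rewrite patchE; case: ifPn => // _; rewrite lee_fin sqr_ge0.
  apply: eq_integral => u _; rewrite !patchE !mem_setE /= !in_itv/= andbT.
  rewrite add0r oppr_gt0; case: ifP => // _; rewrite /f.
  by rewrite -[in RHS]sqrrN opprB.
(* For [u >= 0] the term [nu (- u)] vanishes, and [u |-> t - u] carries this half-line to []-oo,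
   t]]. *)
have -> // : \int[mu]_(u in `[0%R, +oo[) f u = G t.
rewrite integral_mkcond [RHS]integral_mkcond.
rewrite -[RHS](@ge0_integral_reflect _ t); last 2 first.
- exact: mg.
- by move=> x; rewrite patchE; case: ifPn => // _; rewrite lee_fin sqr_ge0.
apply: eq_integral => u _; rewrite !patchE !mem_setE /= !in_itv/= andbT.
rewrite gerBl; case: ifP => // u0.
by rewrite /f (@levy_tail_le0 _ _ (- u)) ?oppr_le0// subr0.
Qed.

Lemma kernel_energy_tail_ge0 (t : R) : 0 <= H t.
Proof. by apply: integral_ge0 => s _; rewrite lee_fin sqr_ge0. Qed.

Lemma levy_tail_energy_nondecreasing (s t : R) : (s <= t)%R -> G s <= G t.
Proof.
move=> st; apply: ge0_subset_integral => //; first exact: mnu2.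
- by move=> x _; rewrite lee_fin sqr_ge0.
- by apply: subset_itvl; rewrite bnd_simp.
Qed.

Lemma levy_tail_energy_le (t : R) : G t <= V t.
Proof. by rewrite kernel_energyE leeDr// kernel_energy_tail_ge0. Qed.

Lemma kernel_energy_nondecreasing (s t : R) : (0 <= s)%R -> (s <= t)%R ->
  V s <= V t.
Proof.
move=> s0 st; rewrite !kernel_energyE leeD ?levy_tail_energy_nondecreasing//.
apply: ge0_le_integral => //.
- by move=> x _; rewrite lee_fin sqr_ge0.
- exact: mdiff2.
- exact: mdiff2.
move=> x /=; rewrite in_itv/= andbT => x0.
have h1 : (nu (t + x) <= nu (s + x))%R.
  by apply: nu_ni; [rewrite ltr_wpDl|rewrite lerD2r].
have h2 : (nu (s + x) <= nu x)%R by apply: nu_ni => //; rewrite lerDr.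
by rewrite lee_fin lerXn2r ?nnegrE ?subr_ge0// ?(le_trans h1)// lerB.
Qed.

(** Each of [H t] and [G t] is at most the squared norm of [nu]: the first because
    [0 <= nu x - nu (t + x) <= nu x], the second by inclusion of domains. *)
Lemma kernel_energy_le (t : R) : (0 <= t)%R ->
  V t <= \int[mu]_x (nu x ^+ 2)%:E + \int[mu]_x (nu x ^+ 2)%:E.
Proof.
move=> t0; rewrite kernel_energyE; apply: leeD; last first.
  apply: ge0_subset_integral => //; first exact: mnu2.
  by move=> x _; rewrite lee_fin sqr_ge0.
apply: (@le_trans _ _ (\int[mu]_(x in `]0%R, +oo[) (nu x ^+ 2)%:E)); last first.
  apply: ge0_subset_integral => //; first exact: mnu2.
  by move=> x _; rewrite lee_fin sqr_ge0.
apply: ge0_le_integral => //; try exact: mnu2; try exact: mdiff2.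
- by move=> x _; rewrite lee_fin sqr_ge0.
- move=> x /=; rewrite in_itv/= andbT => x0.
  have h2 : (nu (t + x) <= nu x)%R by apply: nu_ni => //; rewrite lerDr.
  by rewrite lee_fin lerXn2r ?nnegrE ?subr_ge0// gerBl.
Qed.

(** Beyond [a] the integrand is at most [nu a ^+ 2], on an interval of length at most [t]. *)
Lemma levy_tail_energy_le_linear (a t : R) : (0 < a)%R -> (0 <= t)%R ->
  G t <= G a + (t * nu a ^+ 2)%:E.
Proof.
move=> a0 t0; have [ta|at_] := leP t a.
  apply: (le_trans (levy_tail_energy_nondecreasing ta)).
  by rewrite leeDl// lee_fin mulr_ge0 ?sqr_ge0.
have -> : `]-oo, t]%classic = `]-oo, a] `|` `]a, t] :> set R.
  by rewrite -itv_bndbnd_setU// bnd_simp ltW.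
rewrite ge0_integral_setU//; last 3 first.
- exact: mnu2.
- by move=> x _; rewrite lee_fin sqr_ge0.
- apply/disj_setPS => x [] /=; rewrite !in_itv/= => xa /andP[].
  by rewrite ltNge xa.
rewrite leeD2l//.
apply: (@le_trans _ _ (\int[mu]_(x in `]a, t]) cst (nu a ^+ 2)%:E x)).
  apply: ge0_le_integral => //; try exact: mnu2.
  - by move=> x _; rewrite lee_fin sqr_ge0.
  - move=> x /=; rewrite in_itv/= => /andP[ax _].
    by rewrite lee_fin lerXn2r ?nnegrE// nu_ni// ltW.
rewrite integral_cst//= lebesgue_measure_itv/= lte_fin at_ -EFinB -EFinM lee_fin.
by rewrite mulrC ler_wpM2r ?sqr_ge0// gerBl ltW.
Qed.

(** One [G a] and one linear term come from [G t]. The other pair comes from [H t] split at [a]: up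
    to [a] the difference is at most [nu x], which costs at most [G a]. *)
Lemma kernel_energy_le_linear (a t : R) : (0 < a)%R -> (0 <= t)%R ->
  V t <= G a + G a + (2 * (t * nu a ^+ 2))%:E.
Proof.
move=> a0 t0; rewrite kernel_energyE.
have -> : (2 * (t * nu a ^+ 2))%:E = (t * nu a ^+ 2)%:E + (t * nu a ^+ 2)%:E.
  by rewrite -EFinD; congr EFin; ring.
rewrite [leRHS]addeACA; apply: leeD; last first.
  exact: levy_tail_energy_le_linear.
have -> : `]0%R, +oo[%classic = `]0%R, a] `|` `]a, +oo[ :> set R.
  by rewrite -itv_bndbnd_setU// bnd_simp ltW.
rewrite ge0_integral_setU//; last 3 first.
- exact: mdiff2.
- by move=> x _; rewrite lee_fin sqr_ge0.
- apply/disj_setPS => x [] /=; rewrite !in_itv/= andbT => /andP[_ xa].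
  by rewrite ltNge xa.
have nud x : (0 < x)%R -> (0 <= nu x - nu (t + x) <= t * nubar x)%R.
  move=> x0; have xtx : (x <= t + x)%R by rewrite lerDr.
  rewrite subr_ge0 nu_ni//=.
  by have /andP[_] := levy_tail_diff nubar_cm nubar_levy x0 xtx; rewrite addrK.
apply: leeD.
  apply: (@le_trans _ _ (\int[mu]_(x in `]0%R, a]) (nu x ^+ 2)%:E)); last first.
    apply: ge0_subset_integral => //; first exact: mnu2.
    - by move=> x _; rewrite lee_fin sqr_ge0.
    - by move=> x /=; rewrite !in_itv/= => /andP[].
  apply: ge0_le_integral => //; try exact: mnu2; try exact: mdiff2.
  - by move=> x _; rewrite lee_fin sqr_ge0.
  - move=> x /=; rewrite in_itv/= => /andP[x0 _].
    have /andP[h1 _] := nud x x0.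
    by rewrite lee_fin lerXn2r ?nnegrE// gerBl.
have msub : measurable_fun `]a, +oo[%classic nubar.
  case: nubar_levy => + _ _; apply: measurable_funS => // x /=.
  by rewrite !in_itv/= !andbT; exact: lt_trans.
have nubar0 x : (`]a, +oo[%classic : set R) x -> 0 <= (nubar x)%:E.
  rewrite /= in_itv/= andbT lee_fin => ax.
  by case: nubar_levy => _ + _; apply; exact: lt_trans ax.
(* One factor of the square is bounded by [nu a] and the other by [t * nubar x]; integrating [nubar]
   over []a, +oo[] produces the second [nu a]. *)
apply: (@le_trans _ _ (\int[mu]_(x in `]a, +oo[)
    ((nu a * t)%:E * (nubar x)%:E))); last first.
  rewrite ge0_integralZl//; last 2 first.
  - exact/measurable_EFinP.
  - by rewrite lee_fin mulr_ge0.
  rewrite -levy_tailE// -EFinM lee_fin.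
  by rewrite (_ : nu a * t * nu a = t * nu a ^+ 2)%R//; ring.
apply: ge0_le_integral => //; try exact: mdiff2.
- by move=> x _; rewrite lee_fin sqr_ge0.
- by apply/measurable_EFinP; exact: measurable_funM.
move=> x /=; rewrite in_itv/= andbT => ax.
have /andP[h1 h2] := nud x (lt_trans a0 ax).
rewrite -EFinM lee_fin expr2 -mulrA ler_pM//.
by rewrite (@le_trans _ _ (nu x))// ?gerBl// nu_ni// ltW.
Qed.

Lemma levy_tail_energy1_gt0 (x : R) : (0 < x)%R -> (0 < nubar x)%R -> 0 < G 1.
Proof.
(* [y < x] lets the mass of [nubar] on []y, x]] make [nu y] positive, and [y <= 1] puts []0, y]]
   inside the domain of [G 1]. *)
move=> x0 nx0; pose y := Num.min (x / 2)%R 1%R.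
have y0 : (0 < y)%R by rewrite lt_min divr_gt0//= ltr01.
have yx : (y < x)%R by rewrite gt_min ltr_pdivrMr// ltr_pMr// ltr1n.
have nuy : (0 < nu y)%R.
  have /andP[h _] := levy_tail_diff nubar_cm nubar_levy y0 (ltW yx).
  have : (0 < (x - y) * nubar x)%R by rewrite mulr_gt0// subr_gt0.
  by move=> /lt_le_trans/(_ h)/lt_le_trans; apply; rewrite gerBl.
apply: (@lt_le_trans _ _ (\int[mu]_(z in `]0%R, y]) cst (nu y ^+ 2)%:E z)).
  rewrite integral_cst//= lebesgue_measure_itv/= lte_fin y0 -EFinB -EFinM lte_fin.
  by rewrite mulr_gt0 ?exprn_gt0// subr0.
apply: (@le_trans _ _ (\int[mu]_(z in `]0%R, y]) (nu z ^+ 2)%:E)).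
  apply: ge0_le_integral => //; try exact: mnu2.
  - by move=> z _; rewrite lee_fin sqr_ge0.
  - move=> z /=; rewrite in_itv/= => /andP[z0 zy].
    by rewrite lee_fin lerXn2r ?nnegrE// nu_ni.
apply: ge0_subset_integral => //; first exact: mnu2.
- by move=> z _; rewrite lee_fin sqr_ge0.
- move=> z /=; rewrite !in_itv/= => /andP[_ zy]; apply: (le_trans zy).
  by rewrite ge_min lexx orbT.
Qed.

Lemma Lp_on_levy_tail :
  Lp_on `]0%R, +oo[ 2 nu <-> \int[mu]_x (nu x ^+ 2)%:E < +oo.
Proof.
rewrite /Lp_on.
have -> : nu \_ `]0%R, +oo[ = nu.
  apply/funext => x; rewrite patchE; case: ifPn => //.
  rewrite notin_setE/= in_itv/= andbT => /negP; rewrite -leNgt => x0.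
  by rewrite levy_tail_le0.
by split=> [/Lfun2P[]|nu2] //; apply/Lfun2P.
Qed.

(** Monotone convergence along the half-lines []-oo, n]], which exhaust the line. *)
Lemma levy_tail_energy_unbounded (M : R) :
  \int[mu]_x (nu x ^+ 2)%:E = +oo -> exists n : nat, M%:E <= G n%:R.
Proof.
move=> Soo.
pose F (i : nat) : set (measurableTypeR R) := `]-oo, i%:R%R]%classic.
have nndF : nondecreasing_seq F.
  move=> i j ij; rewrite subsetEset; apply: subset_itvl.
  by rewrite bnd_simp ler_nat.
have mF i : measurable (F i) by exact: measurable_itv.
have f0 i (z : R) : F i z -> 0 <= (nu z ^+ 2)%:E by rewrite lee_fin sqr_ge0.
have bigE : \bigcup_i F i = [set: R].
  apply/seteqP; split=> // z _; exists (Num.truncn z).+1 => //.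
  by rewrite /F/= in_itv/= ltW// truncnS_gt.
have mf i : measurable_fun (F i) (fun z => (nu z ^+ 2)%:E) by exact: mnu2.
have := @ge0_nondecreasing_set_cvg_integral _ _ R F _ mu nndF mF mf f0.
rewrite bigE Soo => /cvgeyPge/(_ M)[n _ /(_ n (leqnn n))] h.
by exists n.
Qed.

End kernel_energy.

(** * The variance of [B t] and its long-time limits *)

Section bernstein_motion_variance.
Context (R : realType) (d : measure_display) (T : measurableType d).
Variables (P : probability T R) (W : R -> {RV P >-> R}).
Local Notation mu := (@lebesgue_measure R).
Local Open Scope ereal_scope.

Lemma bernstein_motion_variance (nu : R -> R) (B : R -> {RV P >-> R}) (t : R) :
  two_sided_wiener W -> is_bernstein_motion W nu B -> (0 <= t)%R ->
  (0 <= C_const nu)%R ->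
  \int[mu]_u (increment_kernel nu t u ^+ 2)%:E \is a fin_num /\
  'V_P[B t] = (C_const nu * wiener_unit_variance W)%:E *
    \int[mu]_u (increment_kernel nu t u ^+ 2)%:E.
Proof.
move=> hW hB t0 C0; have [I hI BI] := hB t t0.
have [Vfin I2 VI] := wiener_integral_isometry hW hI; split=> //.
pose Y : {RV P >-> R} := (Num.sqrt (C_const nu) \o* I)%R.
have -> : 'V_P[B t] = 'V_P[Y].
  by apply: ae_eq_variance; apply: filterS BI => w ->; rewrite /= mulrC.
(* The sign condition on [C_const nu] makes its square root square back to it. *)
by rewrite varianceZ// sqr_sqrtr// VI muleA -EFinM.
Qed.

End bernstein_motion_variance.

(** If [nubar] vanished on the positive reals, so would [phi], against its divergence at infinity.
    This excludes a zero kernel, for which the variance would vanish identically. *)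
Lemma levy_density_gt0 (R : realType) (phi nubar : R -> R) :
  levy_density nubar ->
  (forall x : R, 0 < x -> (phi x)%:E = levy_exponent nubar x) ->
  phi x @[x --> +oo] --> +oo -> exists2 x, 0 < x & 0 < nubar x.
Proof.
move=> [_ nubar0 _] phiE phioo; apply: contrapT => noex.
have nubarE x : 0 < x -> nubar x = 0.
  move=> x0; apply/eqP; rewrite eq_le nubar0// andbT leNgt.
  by apply/negP => nx; apply: noex; exists x.
have phi_eq0 x : 0 < x -> phi x = 0.
  move=> x0; have := phiE x x0; rewrite /levy_exponent integral0_eq.
    by case.
  by move=> s /=; rewrite in_itv/= andbT => s0; rewrite nubarE// mulr0.
near +oo_R => x.
have : 1 <= phi x by near: x; exact: (cvgryPge _).1 phioo 1.
by rewrite phi_eq0 ?ler10.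
Unshelve. all: by end_near. Qed.

Theorem corollary5p1 (R : realType) (d : measure_display)
    (T : measurableType d) (P : probability T R)
    (W : R -> {RV P >-> R}) (phi nubar : R -> R) (B : R -> {RV P >-> R})
    (hW : two_sided_wiener W)
    (hphi : complete_bernstein phi)
    (hnubar_cm : completely_monotone nubar)
    (hnubar_levy : levy_density nubar)
    (hphiE : forall x : R, 0 < x -> (phi x)%:E = levy_exponent nubar x)
    (hphi0 : phi x @[x --> 0^'+] --> (0 : R))
    (hphioo : phi x @[x --> +oo] --> +oo)
    (hnubar2 : Lp_on `]1, +oo[ 2 nubar)
    (hnu2 : Lp_on `]0, 1[ 2 (levy_tail nubar))
    (hnup : exists2 p : R, 1 <= p & Lp_on `]1, +oo[ p (levy_tail nubar))
    (hB : is_bernstein_motion W (levy_tail nubar) B) :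
  (Lp_on `]0, +oo[ 2 (levy_tail nubar) ->
     exists2 C : R, 0 < C & 'V_P[B t] @[t --> +oo] --> C%:E) /\
  (~ Lp_on `]0, +oo[ 2 (levy_tail nubar) ->
     'V_P[B t] @[t --> +oo] --> +oo%E /\
     ('V_P[B t] * (t^-1)%:E)%E @[t --> +oo] --> 0%E).
Proof.
set nu := levy_tail nubar in hnu2 hnup hB *.
pose V t := (\int[lebesgue_measure]_u (increment_kernel nu t u ^+ 2)%:E)%E.
pose G t := (\int[@lebesgue_measure R]_(x in `]-oo, t]) (nu x ^+ 2)%:E)%E.
have C0 : 0 <= C_const nu.
  by rewrite invr_ge0 Rintegral_ge0// => u _; rewrite sqr_ge0.
(* The kernel is square integrable because it has a Wiener integral, hence is an L2 limit of step
   functions. *)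
have Vfin t : 0 <= t -> V t \is a fin_num.
  by move=> t0; have [] := bernstein_motion_variance hW hB t0 C0.
have V0 t : (0 <= V t)%E.
  by apply: integral_ge0 => u _; rewrite lee_fin sqr_ge0.
have VGt0 : (0 < G 1%R)%E.
  have [x x0 nx] := levy_density_gt0 hnubar_levy hphiE hphioo.
  exact: levy_tail_energy1_gt0 nx.
have V1 : (0 < V 1%R)%E.
  exact: lt_le_trans VGt0 (levy_tail_energy_le hnubar_cm hnubar_levy 1).
(* [C_const nu] is the inverse of the real value of [V 1]; since an infinite integral has real value
   0 and the inverse of 0 is 0, both finiteness and positivity of [V 1] matter. *)
have Cgt0 : 0 < C_const nu by rewrite invr_gt0 fine_gt0// V1 -ge0_fin_numE ?Vfin// ltW.
pose k := C_const nu * wiener_unit_variance W.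
have k0 : 0 < k by rewrite mulr_gt0// wiener_unit_variance_gt0.
have VE t : 0 <= t -> 'V_P[B t] = (k%:E * V t)%E.
  by move=> t0; have [] := bernstein_motion_variance hW hB t0 C0.
(* Freezing the energy at time 0 for negative times gives a function nondecreasing on the whole
   line, whose limit at +oo is its supremum; it agrees with the variance for [t >= 0]. *)
pose g (t : R) := (k%:E * V (Num.max t 0%R))%E.
have g_nd : nondecreasing_fun g.
  move=> s t st; apply: lee_wpmul2l; first by rewrite lee_fin ltW.
  apply: kernel_energy_nondecreasing => //; first by rewrite le_max lexx orbT.
  by rewrite ge_max !le_max st lexx orbT.
have cvgB : 'V_P[B t] @[t --> +oo] --> ereal_sup (range g).
  apply: cvg_trans (nondecreasing_cvge g_nd).
  apply: near_eq_cvg; near=> t.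
  have t0 : 0 <= t by near: t; exact: nbhs_pinfty_ge.
  by rewrite /g max_l// VE.
split=> [/(Lp_on_levy_tail hnubar_cm hnubar_levy) nu2|].
  set S := (\int[_]_x _)%E in nu2.
  have S0 : (0 <= S)%E by apply: integral_ge0 => x _; rewrite lee_fin sqr_ge0.
  have sup_le : (ereal_sup (range g) <= k%:E * (S + S))%E.
    apply: ge_ereal_sup => _ [t _ <-].
    apply: lee_wpmul2l; first by rewrite lee_fin ltW.
    by apply: kernel_energy_le => //; rewrite le_max lexx orbT.
  have sup_gt0 : (0 < ereal_sup (range g))%E.
    apply: (@lt_le_trans _ _ (g 1)); last by apply: ereal_sup_ubound; exists 1.
    by rewrite /g max_l// mule_gt0 ?lte_fin.
  have sup_fin : ereal_sup (range g) \is a fin_num.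
    rewrite ge0_fin_numE ?ltW// (le_lt_trans sup_le)//.
    by rewrite lte_mul_pinfty ?lee_fin ?ltW// lte_add_pinfty.
  exists (fine (ereal_sup (range g))); last by rewrite fineK.
  by rewrite -lte_fin fineK.
move=> notL2; split.
  have Soo : (\int[@lebesgue_measure R]_x (nu x ^+ 2)%:E = +oo)%E.
    apply/eqP; rewrite -leye_eq leNgt; apply/negP => nu2.
    by apply: notL2; apply/(Lp_on_levy_tail hnubar_cm hnubar_levy).
  suff -> : +oo%E = ereal_sup (range g) by [].
  apply/esym/eq_infty => M.
  have [n Mn] := levy_tail_energy_unbounded hnubar_cm hnubar_levy (M / k) Soo.
  have -> : M%:E = (k%:E * (M / k)%:E)%E.
    by rewrite -EFinM mulrC divfK// gt_eqF.
  apply: (@le_trans _ _ (g n%:R)); last by apply: ereal_sup_ubound; exists n%:R.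
  apply: lee_wpmul2l; first by rewrite lee_fin ltW.
  rewrite (max_l (ler0n R n)); apply: (le_trans Mn).
  exact: levy_tail_energy_le.
apply: (@cvg_trans _ ((k * fine (V t) / t)%:E @[t --> +oo])).
  apply: near_eq_cvg; near=> t.
  have t0 : 0 <= t by near: t; exact: nbhs_pinfty_ge.
  by rewrite VE// -(fineK (Vfin t t0)) -!EFinM.
apply: cvg_EFin; first exact: nearW.
apply/cvgrPdist_le => e e0.
(* This value satisfies both [4 * k * dl <= e] and [dl <= 1]; the latter turns [nu a < dl] into
   [nu a ^+ 2 <= dl]. *)
pose dl := e / (4 * k + e).
have N0 : 0 < 4 * k + e by rewrite addr_gt0// mulr_gt0.
have dl0 : 0 < dl by rewrite divr_gt0.
have [a a1 nua] := levy_tail_small hnubar_levy dl0.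
have a0 : 0 < a by exact: lt_le_trans a1.
have G0 : (0 <= G a)%E by apply: integral_ge0 => x _; rewrite lee_fin sqr_ge0.
have Gfin : G a \is a fin_num.
  rewrite ge0_fin_numE//.
  apply: le_lt_trans (levy_tail_energy_le hnubar_cm hnubar_levy a) _.
  by have := Vfin a (ltW a0); rewrite ge0_fin_numE ?V0.
set ga := fine (G a).
have ga0 : 0 <= ga by exact: fine_ge0.
near=> t.
have t1 : 1 <= t by near: t; exact: nbhs_pinfty_ge.
(* The linear bound gives [k * V t / t <= 2 * k * ga / t + 2 * k * dl]; this choice of [t] makes the
   first term at most [e / 2], and [dl] does the same for the second. *)
have tg : 4 * k * ga / e <= t by near: t; apply: nbhs_pinfty_ge; exact: num_real.
have t0 : 0 < t by exact: lt_le_trans t1.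
have := kernel_energy_le_linear hnubar_cm hnubar_levy a0 (ltW t0).
rewrite -/nu -/(V t) -/(G a) -(fineK Gfin) -(fineK (Vfin t (ltW t0))) -/ga.
rewrite -!EFinD lee_fin => Vle.
have v0 : 0 <= fine (V t) by apply: fine_ge0; exact: V0.
rewrite sub0r normrN ger0_norm; last first.
  by apply: divr_ge0; [apply: mulr_ge0 => //; exact: ltW|exact: ltW].
rewrite ler_pdivrMr//.
have n0 : 0 <= nu a by exact: levy_tail_ge0.
have dlE : dl * (4 * k + e) = e by rewrite divfK// gt_eqF.
have dl1 : dl <= 1 by rewrite ler_pdivrMr// mul1r lerDr mulr_ge0// ltW.
have nu2le : nu a ^+ 2 <= dl.
  apply: (@le_trans _ _ (dl ^+ 2)); first by rewrite lerXn2r ?nnegrE//; exact: ltW.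
  by rewrite expr2 ler_piMr// ltW.
have kd : 4 * (k * dl) <= e.
  have : 0 <= dl * e by rewrite mulr_ge0// ltW.
  by lra.
have step1 : k * fine (V t) <= k * (ga + ga + 2 * (t * dl)).
  rewrite ler_pM2l// (le_trans Vle)// lerD2l.
  by rewrite ler_pM2l// ler_pM2l.
have tg' : 4 * k * ga <= e * t by rewrite (mulrC e) -ler_pdivrMr.
have : 4 * (k * dl) * t <= e * t by rewrite ler_pM2r.
lra.
Unshelve. all: by end_near. Qed.
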